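(* Let $G$ be a finitely generated Abelian group. (1) If $S$ is a finite symmetric generating set of $G$, then $$\limsup_{r \to \infty} \frac{\beta_{G,S}(r)}{\beta_{\operatorname{rk} G}(r)} \ge |\operatorname{tors} G|.$$ (2) If $S$ is a finite monoid generating set of $G$, then $$\limsup_{r \to \infty} \frac{\beta_{G,S}(r)}{\beta^+_{\operatorname{rk} G}(r)} \ge |\operatorname{tors} G|.$$
   Context: $\mathbb{N}$ contains $0$. A subset $A$ of a group is symmetric if $g^{-1} \in A$ for all $g \in A$. For a finitely generated group $G$ with neutral element $e$ and a finite monoid generating set $S \subset G$ (not necessarily symmetric; every element of $G$ is a finite, possibly empty, product of elements of $S$; a symmetric generating set of a group is in particular a monoid generating set), define $d_S(g,h) := \min\{ n \in \mathbb{N} \mid \exists s_1,\dots,s_n \in S : h^{-1} g = s_1 \cdots s_n\}$ for $g,h \in G$. The ball of radius $r \in \mathbb{N}$ is $B_{G,S}(r) := \{ g \in G \mid d_S(g,e) \le r\}$, and the growth function of $G$ with respect to $S$ is $\beta_{G,S} \colon \mathbb{N} \to \mathbb{N}$, $\beta_{G,S}(r) := |B_{G,S}(r)|$. For $d \in \mathbb{N}$ let $E_d \subset \mathbb{Z}^d$ be the standard basis and $v_d := (-1,\dots,-1) \in \mathbb{Z}^d$; the standard growth functions are $\beta_d := \beta_{\mathbb{Z}^d, E_d \cup (-E_d)}$ and $\beta^+_d := \beta_{\mathbb{Z}^d, E_d \cup \{v_d\}}$. For a finitely generated Abelian group $G$, $\operatorname{tors} G$ denotes the (finite) subgroup of all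 elements of finite order, and $\operatorname{rk} G$ denotes the rank of the free Abelian group $G/\operatorname{tors} G$. *)

(* Defs.v *)
From HB Require Import structures.
From mathcomp Require Import all_boot all_order all_algebra ring_quotient.
From mathcomp Require Import finmap.
From mathcomp Require Import all_classical all_reals all_analysis.

Set Implicit Arguments.
Unset Strict Implicit.
Unset Printing Implicit Defensive.

Import Order.TTheory GRing.Theory Num.Theory.

Local Open Scope ring_scope.
Local Open Scope classical_set_scope.

(* Abelian groups are written additively, so a product of elements of S is the
   sum of a list of elements of S, and h^-1 g is g - h. *)

Section Growth.
Variable G : zmodType.

Definition symmetric_set (S : {fset G}) : Prop :=
  forall x, x \in S -> - x \in S.

Definition group_generating (S : {fset G}) : Prop :=
  forall g : G, exists s : seq G,
    (forall x, x \in s -> (x \in S) \/ (- x \in S)) /\ g = \sum_(x <- s) x.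

Definition monoid_generating (S : {fset G}) : Prop :=
  forall g : G, exists s : seq G, {subset s <= S} /\ g = \sum_(x <- s) x.

Definition finitely_generated : Prop := exists S : {fset G}, group_generating S.

Definition word_lengths (S : {fset G}) (g h : G) : set nat :=
  [set n | exists s : seq G,
     [/\ size s = n, {subset s <= S} & g - h = \sum_(x <- s) x]].

(* The minimum exists when S generates G as a monoid; it is 0 by convention
   when word_lengths S g h is empty. *)
Definition word_dist (S : {fset G}) (g h : G) : nat :=
  xget 0%N [set n | word_lengths S g h n /\
                    forall m, word_lengths S g h m -> (n <= m)%N].

Definition ball (S : {fset G}) (r : nat) : set G :=
  [set g | (word_dist S g 0 <= r)%N].

(* Balls are finite when S generates G as a monoid; fset_set is the empty
   finite set on infinite sets. *)
Definition growth (S : {fset G}) (r : nat) : nat := #|` fset_set (ball S r)|.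

Definition tors_set : set G := [set x | exists2 n, (0 < n)%N & x *+ n = 0].

Definition tors : {pred G} := fun x => `[< tors_set x >].

Lemma tors_zmod_closed : zmod_closed tors.
Proof.
split; first by apply/asboolP; exists 1%N.
move=> x y /asboolP[m m0 xm] /asboolP[n n0 yn]; apply/asboolP.
exists (m * n)%N; first by rewrite muln_gt0 m0.
by rewrite mulrnBl mulrnA xm mul0rn mulnC mulrnA yn mul0rn subr0.
Qed.

HB.instance Definition _ := GRing.isZmodClosed.Build G tors tors_zmod_closed.

End Growth.

Arguments tors_set : clear implicits.
Arguments tors : clear implicits.

Definition free_abelian_of_rank (V : zmodType) (d : nat) : Prop :=
  exists f : {additive V -> 'rV[int]_d}, bijective f.

(* 0 by convention when G / tors G is not free of finite rank, which does not
   happen for finitely generated G. *)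
Definition rk (G : zmodType) : nat :=
  xget 0%N [set d | free_abelian_of_rank (Quotient.quot (tors G)) d].

Definition std_basis (d : nat) : {fset 'rV[int]_d} :=
  [fset delta_mx 0 i | i in 'I_d]%fset.

Definition neg_std_basis (d : nat) : {fset 'rV[int]_d} :=
  [fset - x | x in std_basis d]%fset.

Definition std_growth (d : nat) : nat -> nat :=
  growth (std_basis d `|` neg_std_basis d)%fset.

Definition std_growth_plus (d : nat) : nat -> nat :=
  growth (std_basis d `|` [fset (const_mx (-1) : 'rV[int]_d)])%fset.

(* Main.v *)
Require Import Defs.
From mathcomp Require Import all_boot all_order all_algebra.
From mathcomp Require Import generic_quotient ring_quotient.
From mathcomp Require Import finmap.
From mathcomp Require Import all_classical all_reals all_analysis.
From mathcomp Require Import zify lra.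

(** Both parts compare the ball of radius r in G with the ball of radius r in
    Z^d, d being the rank of G, at the price of enlarging the radius in G by a
    constant: for every finite set T of torsion elements there is c with

      #|T| * beta(r) <= beta_{G,S}(r + c)    for all r,

    where beta is the relevant standard growth function
    (symmetric_growth_comparison and monoid_growth_comparison).  This suffices:
    if the ratio beta_{G,S} / beta stayed below some l < #|T| from some radius
    on, then beta (r + c) >= (#|T| / l) * beta r for all large r, and beta would
    grow exponentially, whereas growth functions of abelian groups are
    polynomially bounded (limsup_ratio_ge).  As the finite set T is arbitrary,
    the cardinality of the whole torsion subgroup is bounded (counting_le).

    The comparisons use the map phi : G -> Q^d which kills torsion (rank_map).
    For symmetric S, elements s_1, ..., s_d of S with linearly independent
    images embed Z^d into G without increasing word length, and its translates
    by distinct torsion elements are disjoint.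

    For general S a basis is not enough.  An element of Z^d has a shortest
    expression in e_1, ..., e_d, v_d that omits a generator (the sum of all
    generators is 0), so the standard ball of radius r is covered by d + 1
    simplices, each with as many points as there are x in N^d with sum at most
    r (std_growth_plus_le).  It remains to find in the image of S at least
    d + 1 bases of Q^d with pairwise disjoint open cones; then the combinations
    with positive coefficients of each basis produce that many disjoint
    simplices in G.  Such bases exist in any finite set that generates a group
    as a monoid (positive_fan).  They are built upwards along a chain of
    subspaces W: take a minimal set C of generators outside W having a relation
    with positive coefficients modulo W.  Minimality makes this relation the
    only one up to scaling, so C minus any one of its elements is independent
    modulo W, and the #|C| cones obtained in this way are disjoint modulo W.
    Extending each of the more than dim W bases of W in these #|C| ways gives at
    least (dim W + 1) * #|C| >= dim W + #|C| bases of the larger space, whose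
    dimension is dim W + #|C| - 1. *)

Import Order.TTheory GRing.Theory Num.Theory.

Set Implicit Arguments.
Unset Strict Implicit.
Unset Printing Implicit Defensive.

Local Open Scope ring_scope.

(** * Disjoint simplicial cones spanned by a positively spanning set *)

Section PositiveFan.
Variables (K : realFieldType) (E : vectType K).
Implicit Types (W : {vspace E}) (X T S : seq E) (a b c : E -> K).

Local Notation comb X a := (\sum_(x <- X) a x *: x).

Lemma comb_mem W X a : {subset X <= W} -> comb X a \in W.
Proof. by move=> XW; rewrite big_seq memv_suml// => x /XW; exact: memvZ. Qed.

Lemma combB X a b : comb X (fun x => a x - b x) = comb X a - comb X b.
Proof. by rewrite -sumrB; apply: eq_bigr => x _; rewrite scalerBl. Qed.

Lemma combZ X k a : comb X (fun x => k * a x) = k *: comb X a.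
Proof. by rewrite scaler_sumr; apply: eq_bigr => x _; rewrite scalerA. Qed.

Lemma freeP_comb X :
  reflect (uniq X /\ forall a, comb X a = 0 -> {in X, forall x, a x = 0})
          (free X).
Proof.
have combE a : comb X a = \sum_(i < size X) a X`_i *: X`_i.
  by rewrite (big_nth 0) big_mkord.
apply: (iffP idP) => [Xfree|[Xuniq X0]].
  split=> [|a a0 x xX]; first exact: free_uniq.
  have [k _ kE] := free_span Xfree (mem0v _).
  rewrite (kE a)// -(kE (fun=> 0))// big1// => y _; exact: scale0r.
apply/(@freeP _ _ _ (in_tuple X)) => k k0 i.
pose a x := if insub (index x X) is Some j then k j else 0.
have aE (j : 'I_(size X)) : a X`_j = k j.
  by rewrite /a index_uniq// valK.
rewrite -aE; apply: X0; last exact: mem_nth.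
by rewrite combE -[RHS]k0; apply: eq_bigr => j _; rewrite aE.
Qed.

Lemma seq_argmin X (f : E -> K) : X != [::] ->
  exists2 y, y \in X & {in X, forall x, f y <= f x}.
Proof.
elim: X => // x [_ _|y X /(_ isT)[z zX zmin] _].
  by exists x; rewrite ?mem_head// => u; rewrite inE => /eqP->.
have [xz|zx] := leP (f x) (f z).
  exists x; rewrite ?mem_head// => u; rewrite inE => /predU1P[->//|/zmin].
  exact: le_trans.
exists z => [|u]; first by rewrite in_cons zX orbT.
by rewrite in_cons => /predU1P[->|/zmin//]; exact: ltW.
Qed.

Lemma comb_rem X t a : t \in X -> comb X a = a t *: t + comb (rem t X) a.
Proof. by move=> tX; rewrite (perm_big _ (perm_to_rem tX)) big_cons. Qed.

Definition opp_generated S :=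
  {in S, forall x, exists2 s : seq E, {subset s <= S} & - x = \sum_(y <- s) y}.

(** A circuit of S modulo W all of whose coefficients are positive: the last
    clause says that c spans the relations supported by T modulo W.  Relations
    with nonnegative coefficients exist, because z outside W and a word for
    - z sum to 0.  Take one with smallest support T.  If another relation b
    vanished somewhere on T but not everywhere, then subtracting from c the
    multiple of b at which a first coefficient vanishes would give a smaller
    support. *)
Lemma minimal_positive_relation W S :
    opp_generated S -> ~ {subset S <= W} ->
  exists (T : seq E) (c : E -> K),
    [/\ uniq T, T != [::], {subset T <= S}, {in T, forall x, x \notin W} &
    [/\ {in T, forall x, 0 < c x}, comb T c \in W &
    forall b, comb T b \in W -> forall t, t \in T -> b t = 0 ->
      {in T, forall x, b x = 0}]].
Proof.
move=> Sneg /existsPNP[z zS /negP zW].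
pose U := [seq x <- undup S | x \notin W].
have Uuniq : uniq U by rewrite filter_uniq ?undup_uniq.
have memU x : (x \in U) = (x \notin W) && (x \in S).
  by rewrite mem_filter mem_undup.
pose rel c :=
  [/\ forall x, 0 <= c x, comb U c \in W & has (fun x => 0 < c x) U].
have rel0 : exists c, rel c.
  have [s sS zs] := Sneg z zS.
  have word (w : seq E) : {subset w <= S} ->
      comb U (fun x => (count_mem x w)%:R) - \sum_(y <- w) y \in W.
    elim: w => [|y w IH] wS.
      by rewrite !big_nil big1 ?subrr ?mem0v// => x _; rewrite scale0r.
    have wS' : {subset w <= S}.
      by move=> x xw; apply: wS; rewrite in_cons xw orbT.
    have {}IH := IH wS'.
    have yS := wS y (mem_head _ _).
    rewrite [in X in _ - X]big_cons.
    have -> : comb U (fun x => (count_mem x (y :: w))%:R) =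
        comb U (fun x => (y == x)%:R) + comb U (fun x => (count_mem x w)%:R).
      by rewrite -big_split; apply: eq_bigr => x _ /=; rewrite -scalerDl -natrD.
    rewrite opprD addrACA memvD//.
    have [yW|yW] := boolP (y \in W).
      rewrite big_seq big1 ?add0r ?rpredN// => x.
      rewrite memU => /andP[xW _]; have [yx|] := eqVneq y x.
        by rewrite -yx yW in xW.
      by rewrite scale0r.
    have yU : y \in U by rewrite memU yW.
    rewrite (bigD1_seq y)//= eqxx scale1r big1 ?addr0 ?subrr ?mem0v// => x.
    by rewrite eq_sym => /negPf->; rewrite scale0r.
  exists (fun x => (count_mem x (z :: s))%:R); split.
  - by move=> x; rewrite ler0n.
  - have /word : {subset z :: s <= S}.
      by move=> x; rewrite inE => /predU1P[->|/sS].
    by rewrite big_cons -zs subrr subr0.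
  - by apply/hasP; exists z; rewrite ?memU ?zW// ltr0n/= eqxx.
pose P n := `[< exists2 c, rel c & count (fun x => 0 < c x) U = n >].
have exP : exists n, P n.
  have [c cr] := rel0; exists (count (fun x => 0 < c x) U).
  by apply/asboolP; exists c.
case: (ex_minnP exP) => _ /asboolP[c [c0 cW cU] <-] nmin.
pose T := [seq x <- U | 0 < c x].
have combT : comb U c = comb T c.
  rewrite [RHS]big_filter [RHS]big_mkcond; apply: eq_bigr => x _.
  by case: ltgtP (c0 x) => // <-; rewrite scale0r.
have Tuniq : uniq T by exact: filter_uniq.
have memT x : (x \in T) = (0 < c x) && (x \in U) by rewrite mem_filter.
exists T, c; split.
- exact: Tuniq.
- by rewrite -has_filter.
- by move=> x; rewrite memT memU => /and3P[].
- by move=> x; rewrite memT memU => /and3P[].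
split; [by move=> x; rewrite memT => /andP[]|by rewrite -combT|].
(* applied to b and to - b, this gives b = 0 on T *)
have nonpos b : comb T b \in W -> forall t, t \in T -> b t = 0 ->
    {in T, forall x, b x <= 0}.
  move=> bW t tT bt x xT; rewrite leNgt; apply/negP => bx.
  pose V := [seq y <- T | 0 < b y].
  have [|y] := @seq_argmin V (fun x => c x / b x).
    by rewrite -has_filter; apply/hasP; exists x.
  rewrite mem_filter => /andP[by0 yT] ymin.
  (* the first value at which a coefficient of c - l * b vanishes *)
  pose l := c y / b y.
  have cy : 0 < c y by move: yT; rewrite memT => /andP[].
  have l0 : 0 < l by rewrite divr_gt0.
  pose c' x := if x \in T then c x - l * b x else 0.
  have c'T : comb U c' = comb T (fun x => c x - l * b x).
    rewrite [RHS]big_filter [RHS]big_mkcond big_seq [RHS]big_seq.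
    apply: eq_bigr => u uU.
    by rewrite /c' memT uU andbT; case: ifP; rewrite ?scale0r.
  have c'0 u : 0 <= c' u.
    rewrite /c'; case: ifP => // uT; rewrite subr_ge0.
    have cu : 0 < c u by move: uT; rewrite memT => /andP[].
    have [bu|bu] := ltP 0 (b u); last first.
      by rewrite (le_trans _ (ltW cu))// mulr_ge0_le0// ltW.
    by rewrite -ler_pdivlMr// ymin// mem_filter bu.
  have : P (count (fun x => 0 < c' x) U).
    apply/asboolP; exists c' => //; split=> //.
      by rewrite c'T combB combZ memvB -?combT// memvZ.
    apply/hasP; exists t; first by move: tT; rewrite memT => /andP[].
    by rewrite /c' tT bt mulr0 subr0; move: tT; rewrite memT => /andP[].
  move=> /nmin; rewrite leqNgt => /negP; apply.
  rewrite -!size_filter -/T; apply: (@leq_ltn_trans (size (rem y T))).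
    apply: uniq_leq_size; first exact: filter_uniq.
    move=> u; rewrite mem_filter => /andP[u0 uU].
    have [uT|uT] := boolP (u \in T); last by rewrite /c' (negPf uT) ltxx in u0.
    rewrite (mem_rem_uniq y Tuniq); apply/andP; split=> //.
    apply: contraTneq u0 => ->.
    by rewrite /c' yT /l divfK ?gt_eqF// subrr ltxx.
  by rewrite size_rem//; case: (T) yT.
move=> b bW t tT bt x xT; apply/eqP; rewrite eq_le (nonpos b bW t)//=.
rewrite -oppr_le0 (nonpos (fun x => - b x) _ t)// ?bt ?oppr0//.
by under eq_bigr do rewrite scaleNr; rewrite sumrN rpredN.
Qed.

(** The bases F i of W, taken in S, span simplicial cones whose interiors are
    pairwise disjoint.  At least dim W + 1 of them are required: this is the
    number of maximal cones in the fan of projective space. *)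
Definition fan S W (I : finType) (F : I -> seq E) :=
  [/\ forall i, basis_of W (F i), forall i, {subset F i <= S},
      (\dim W < #|I|)%N &
      forall i j a b,
        {in F i, forall x, 0 < a x} -> {in F j, forall x, 0 < b x} ->
        comb (F i) a = comb (F j) b -> i = j].

Definition has_fan S W := exists (I : finType) (F : I -> seq E), fan S W F.

Lemma has_fan0 S : has_fan S 0.
Proof.
exists unit, (fun=> [::]); split=> //; last by case; case.
  by move=> _; exact: nil_basis.
by rewrite dimv0 card_unit.
Qed.

(** The new bases are the F i completed by all but one element of a positive
    circuit T of S modulo W.  Reducing modulo W recovers the omitted element
    from a positive combination, and then subtracting its part in T recovers
    the index i. *)
Lemma has_fan_step S W :
    opp_generated S -> ~ {subset S <= W} -> has_fan S W ->
  exists2 W', has_fan S W' & (\dim W < \dim W')%N.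
Proof.
move=> Sneg SW [I [F [Fbasis FS cardI Finj]]].
have [T [c [Tuniq T0 TS TW [c0 cW Trel]]]] := minimal_positive_relation Sneg SW.
have FW i : {subset F i <= W} by move=> x; apply: basis_mem.
have remT t : {subset rem t T <= T} by exact: mem_rem.
have comb_remW t b : t \in T -> comb (rem t T) b \in W ->
    {in rem t T, forall x, b x = 0}.
  move=> tT bW x xT.
  have xt : x != t by move: xT; rewrite mem_rem_uniq// inE => /andP[].
  pose b' y := if y == t then 0 else b y.
  have <- : b' x = b x by rewrite /b' (negPf xt).
  apply: (Trel b' _ t tT _ x (remT _ _ xT)); last by rewrite /b' eqxx.
  rewrite (comb_rem b' tT) /b' eqxx scale0r add0r.
  rewrite (eq_big_seq (fun x => b x *: x))// => y.
  by rewrite mem_rem_uniq// inE => /andP[/negPf->].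
pose W' := (W + <<T>>)%VS.
have mem_comb : forall i t a,
    comb (F i ++ rem t T) a = comb (F i) a + comb (rem t T) a.
  by move=> i t a; rewrite big_cat.
(* t itself is recovered from the relation c, whose coefficient at t is
   nonzero *)
have basisW' : forall i t, t \in T -> basis_of W' (F i ++ rem t T).
  move=> i t tT; apply/andP; split.
    rewrite span_cat (span_basis (Fbasis i)); apply/eqP/subv_anti/andP; split.
      by rewrite addvS// sub_span.
    rewrite subv_add addvSl; apply/span_subvP => x xT.
    have [->|xt] := eqVneq x t; last first.
      rewrite (subvP (addvSr _ _))// memv_span// mem_rem_uniq//.
      by rewrite inE xt.
    have ct : c t != 0 by rewrite gt_eqF// c0.
    suff /(memvZ (c t)^-1) : c t *: t \in (W + <<rem t T>>)%VS.
      by rewrite scalerK.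
    have -> : c t *: t = comb T c - comb (rem t T) c.
      by rewrite (comb_rem c tT) addrK.
    rewrite memvB//; first exact: (subvP (addvSl _ _)).
    by apply: (subvP (addvSr _ _)); apply: comb_mem => y; exact: memv_span.
  have /freeP_comb[Funiq Ffree] := basis_free (Fbasis i).
  apply/freeP_comb; split.
    rewrite cat_uniq Funiq rem_uniq// andbT/=.
    by apply/hasPn => x /remT/TW; apply: contra => /FW.
  move=> a; rewrite mem_comb// => a0.
  have aT : {in rem t T, forall x, a x = 0}.
    apply: comb_remW => //.
    by rewrite -(addKr (comb (F i) a) (comb _ a)) a0 addr0 rpredN comb_mem.
  have aF : {in F i, forall x, a x = 0}.
    apply: Ffree; rewrite -[RHS]a0.
    suff -> : comb (rem t T) a = 0 by rewrite addr0.
    by rewrite big_seq big1// => x xT; rewrite aT// scale0r.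
  by move=> x; rewrite mem_cat => /orP[/aF|/aT].
have dimW' : (\dim W' = \dim W + (size T).-1)%N.
  have /card_gt0P[i _] : (0 < #|I|)%N by exact: leq_ltn_trans cardI.
  have [t tT] : exists t, t \in T.
    by case: (T) T0 => // t ? _; exists t; exact: mem_head.
  rewrite -(span_basis (basisW' i t tT)) -(span_basis (Fbasis i)).
  have := basis_free (basisW' i t tT); have := basis_free (Fbasis i).
  by rewrite /free => /eqP-> /eqP->; rewrite size_cat size_rem.
have [t0 t0T] : exists t, t \in T.
  by case: (T) T0 => // t ? _; exists t; exact: mem_head.
exists W'; last first.
  rewrite (ltn_leqif (dimv_leqif_sup (addvSl W <<T>>))).
  apply: contra (TW t0 t0T) => /subvP; apply.
  by rewrite (subvP (addvSr _ _))// memv_span.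
exists (I * seq_sub T)%type, (fun p => F p.1 ++ rem (val p.2) T); split.
- by move=> [i t]; apply: basisW'; exact: valP.
- move=> [i t] x /=; rewrite mem_cat => /orP[/FS//|/remT/TS//].
- rewrite card_prod card_seq_sub// dimW'.
  case: (size T) (size_eq0 T) T0 => [|k] <- // _ /=.
  by rewrite mulnS -addSn leq_add// leq_pmull// (leq_ltn_trans _ cardI).
move=> [i t] [j u] a b /= a0 b0; rewrite !mem_comb => ab.
have tT : val t \in T by exact: valP.
have uT : val u \in T by exact: valP.
pose a' x := if x == val t then 0 else a x.
pose b' x := if x == val u then 0 else b x.
have combE s (e : E -> K) : s \in T ->
    comb T (fun x => if x == s then 0 else e x) = comb (rem s T) e.
  move=> sT; rewrite (comb_rem _ sT) eqxx scale0r add0r.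
  apply: eq_big_seq => y.
  by rewrite mem_rem_uniq// inE => /andP[/negPf->].
have remW : comb (rem (val t) T) a - comb (rem (val u) T) b \in W.
  have -> : comb (rem (val t) T) a - comb (rem (val u) T) b =
            comb (F j) b - comb (F i) a.
    by apply/eqP; rewrite subr_eq addrAC -ab addrAC subrr add0r.
  by rewrite memvB ?comb_mem.
have abW : comb T (fun x => a' x - b' x) \in W.
  by rewrite combB !combE.
have tu : val t = val u.
  apply/eqP/negPn/negP => tu.
  (* every relation supported by T modulo W is a multiple of the positive
     relation c, so it cannot take a negative and a positive value *)
  pose l := (a' (val t) - b' (val t)) / c (val t).
  have ut : (val u == val t) = false by rewrite eq_sym (negPf tu).
  have ct := c0 _ tT; have cu := c0 _ uT.
  have l0 : l < 0.
    rewrite /l pmulr_llt0 ?invr_gt0// /a' /b' eqxx (negPf tu) sub0r oppr_lt0.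
    by apply: b0; rewrite mem_cat mem_rem_uniq// !inE tu tT orbT.
  have : a' (val u) - b' (val u) - l * c (val u) = 0.
    apply: (Trel (fun x => a' x - b' x - l * c x) _ (val t)) => //.
      by rewrite combB combZ memvB// memvZ.
    by rewrite /l divfK ?subrr// gt_eqF.
  move/eqP; rewrite subr_eq0 /a' /b' eqxx ut subr0 => /eqP au.
  have : 0 < a (val u).
    by apply: a0; rewrite mem_cat mem_rem_uniq// !inE ut uT orbT.
  by rewrite au pmulr_lgt0// ltNge ltW.
have aT : {in rem (val t) T, forall x, a x = b x}.
  move=> x xT; apply/eqP; rewrite -subr_eq0; apply/eqP.
  apply: (comb_remW _ (fun x => a x - b x) tT _ _ xT).
  by rewrite combB {2}tu.
have tu' : t = u by exact: val_inj.
have -> : i = j; last by rewrite tu'.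
apply: (Finj i j a b).
- by move=> x xF; apply: a0; rewrite mem_cat xF.
- by move=> x xF; apply: b0; rewrite mem_cat xF.
apply: (addIr (comb (rem (val t) T) a)); rewrite ab; congr (_ + _).
by rewrite -tu; apply: eq_big_seq => x /aT->.
Qed.

(** As long as some element of S lies outside W, a fan in W extends to a fan in
    a larger subspace; starting from 0, this stops at <<S>>. *)
Lemma positive_fan S :
    opp_generated S -> has_fan S <<S>>.
Proof.
move=> Sneg.
have fan_le W : has_fan S W -> (W <= <<S>>)%VS.
  move=> [I [F [Fb FS cardI _]]].
  have /card_gt0P[i _] : (0 < #|I|)%N by exact: leq_ltn_trans cardI.
  by rewrite -(span_basis (Fb i)) sub_span//; exact: FS.
have [n] := ubnP (\dim <<S>> - \dim (0 : {vspace E})%VS); have := has_fan0 S.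
elim: n 0%VS => // n IH W Wfan; rewrite ltnS => Wn.
have [SW|SW] := pselect {subset S <= W}.
  suff <- : W = <<S>>%VS by [].
  by apply/subv_anti; rewrite fan_le//; apply/span_subvP.
have [W' W'fan WW'] := has_fan_step Sneg SW Wfan.
by apply: (IH W') => //; have := dimvS (fan_le _ W'fan); lia.
Qed.

End PositiveFan.

(** * A lower bound for the upper limit of a ratio *)

Section Limsup.
Variable R : realType.

(** With e = q - 1, Bernoulli gives q ^ N >= B := 1 + N * e, so that
    q ^ (N * (m + 1)) >= B ^ (m + 1).  The base of the left-hand side at
    j = N * (m + 1) is at most A * B with A independent of N, and
    A ^ m * B ^ m < B ^ (m + 1) as soon as B > A ^ m. *)
Lemma exponential_beats_polynomial (q : R) (m k c : nat) : 1 < q ->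
  exists j, ((k + j * c + 1) ^ m)%:R < q ^+ j.
Proof.
move=> q1; pose e := q - 1; have e0 : 0 < e by rewrite subr_gt0.
have bernoulli j : 1 + j%:R * e <= q ^+ j.
  elim: j => [|j IH]; first by rewrite mul0r addr0 expr0.
  rewrite exprS (le_trans _ (ler_wpM2l _ IH)) ?(ltW (lt_trans _ q1))//.
  have je : 0 <= j%:R * e * e by rewrite !mulr_ge0 ?ler0n// ltW.
  have -> : q = 1 + e by rewrite /e addrC subrK.
  rewrite -[j.+1]addn1 natrD; lra.
pose A := (k + 1)%:R + (m.+1 * c)%:R / e.
have Ac : (m.+1 * c)%:R = (A - (k + 1)%:R) * e.
  by rewrite /A addrAC subrr add0r divfK// gt_eqF.
have Ak : (k + 1)%:R <= A by rewrite lerDl divr_ge0 ?ler0n// ltW.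
have A0 : 0 <= A by rewrite (le_trans _ Ak).
pose N := Num.Def.truncn (A ^+ m / e).
have N_A : A ^+ m / e < N.+1%:R by rewrite truncnS_gt.
pose B := 1 + N.+1%:R * e.
have B1 : 1 <= B by rewrite lerDl mulr_ge0 ?ler0n// ltW.
exists (N.+1 * m.+1)%N.
have base : (k + N.+1 * m.+1 * c + 1)%:R <= A * B.
  rewrite addnAC natrD -mulnA natrM Ac /B.
  have k1 : 0 <= (k + 1)%:R * (N.+1%:R * e) :> R.
    by rewrite !mulr_ge0 ?ler0n// ltW.
  nra.
rewrite natrX (@le_lt_trans _ _ ((A * B) ^+ m))//.
  by rewrite lerXn2r ?nnegrE ?ler0n// (le_trans _ base).
rewrite exprM (@lt_le_trans _ _ (B ^+ m.+1))//; last first.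
  rewrite lerXn2r ?nnegrE ?bernoulli// ?(le_trans _ B1)//.
  by rewrite exprn_ge0// (ltW (lt_trans _ q1)).
have B0 : 0 < B by rewrite (lt_le_trans _ B1).
rewrite exprMn exprSr mulrC ltr_pM2l ?exprn_gt0//.
by rewrite (@lt_le_trans _ _ (N.+1%:R * e)) -?ltr_pdivrMr// /B lerDr.
Qed.

(** If g / f were at most l < n from k on, then f (r + c) >= (n / l) * f r for
    r >= k, against the polynomial bound on f. *)
Lemma limsup_ratio_ge (f g : nat -> nat) (n m c : nat) :
    (forall r, 0 < f r)%N -> (forall r, f r <= (r + 1) ^ m)%N ->
    (forall r, n * f r <= g (r + c))%N ->
  (n%:R%:E <= limn_esup (fun r => ((g r)%:R / (f r)%:R : R)%:E))%E.
Proof.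
move=> f0 fm fg; case: n fg => [|n] fg.
  apply: limf_esup_ge0 => [[k _ /(_ k (leqnn k))]//|r].
  by rewrite lee_fin divr_ge0// ler0n.
rewrite /limn_esup /limf_esup; apply: le_ereal_inf_tmp => _ [V [k _ kV] <-].
rewrite leNgt; apply/negP.
set s := ereal_sup _ => sn.
have sub r : (k <= r)%N -> ((((g r)%:R / (f r)%:R : R)%:E) <= s)%E.
  by move=> kr; apply: ereal_sup_ubound; exists r => //; exact: kV.
have : s \is a fin_num.
  rewrite fin_numElt (lt_trans sn (ltry _))// andbT.
  by rewrite (lt_le_trans (ltNyr _) (sub k _)).
case: s sub sn => // l sub; rewrite lte_fin => ln _.
have step r : (k <= r)%N -> n.+1%:R * (f r)%:R <= l * (f (r + c)%N)%:R.
  move=> kr; have := sub (r + c)%N (leq_trans kr (leq_addr _ _)).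
  rewrite lee_fin ler_pdivrMr ?ltr0n// => /(le_trans _); apply.
  by rewrite -natrM ler_nat.
have l0 : 0 < l.
  rewrite -(@pmulr_lgt0 _ (f (k + c)%N)%:R) ?ltr0n//.
  by rewrite (lt_le_trans _ (step k _))// mulr_gt0// ltr0n.
pose q := n.+1%:R / l.
have q1 : 1 < q by rewrite ltr_pdivlMr// mul1r.
have grow j : q ^+ j <= (f (k + j * c)%N)%:R.
  elim: j => [|j IH]; first by rewrite expr0 ler1n.
  have := step (k + j * c)%N (leq_addr _ _).
  rewrite -addnA -mulSnr -ler_pdivrMl// mulrA [_^-1 * _]mulrC -/q.
  by apply: le_trans; rewrite exprS ler_wpM2l// ltW// (lt_trans _ q1).
have [j] := exponential_beats_polynomial m k c q1.
by rewrite ltNge (le_trans (grow j))// ler_nat.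
Qed.

End Limsup.

(** * Balls as sets of short words *)

Section Balls.
Variable G : zmodType.
Implicit Types (S : {fset G}) (g : G).

Definition words S r : set G :=
  [set g | exists s : seq G,
     [/\ (size s <= r)%N, {subset s <= S} & g = \sum_(x <- s) x]].

Lemma ball_words S r : monoid_generating S -> Defs.ball S r = words S r.
Proof.
move=> Sgen; apply/seteqP; split=> g; rewrite /Defs.ball /words/= /word_dist.
  case: xgetP => [n _ [[s [<- sS gs]] _] sr|/(_ _)].
    by exists s; rewrite -gs subr0.
  move=> noword; exfalso.
  have [s [sS gs]] := Sgen g.
  have exn : exists n, `[< word_lengths S g 0 n >].
    by exists (size s); apply/asboolP; exists s; rewrite subr0.
  case: (ex_minnP exn) => n /asboolP ng nmin.
  by apply: (noword n); split=> // p /asboolP; exact: nmin.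
move=> [s [sr sS gs]]; case: xgetP => [n _ [_ nmin]|//].
by apply: leq_trans sr; apply: nmin; exists s; rewrite subr0.
Qed.

Lemma words0 S : words S 0 0.
Proof. by exists [::]; split=> //; rewrite big_nil. Qed.

Lemma wordsD S r1 r2 g1 g2 :
  words S r1 g1 -> words S r2 g2 -> words S (r1 + r2) (g1 + g2).
Proof.
move=> [s1 [sr1 sS1 ->]] [s2 [sr2 sS2 ->]]; exists (s1 ++ s2).
rewrite size_cat leq_add// big_cat; split=> // x.
by rewrite mem_cat => /orP[/sS1|/sS2].
Qed.

Lemma wordsMn S n g : g \in S -> words S n (g *+ n).
Proof.
move=> gS; exists (nseq n g); rewrite size_nseq; split=> //.
  by move=> x; rewrite mem_nseq => /andP[_ /eqP->].
by rewrite big_nseq iter_addr_0.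
Qed.

Lemma words_sum S (I : Type) (r : seq I) (n : I -> nat) (h : I -> G) :
  (forall i, words S (n i) (h i)) ->
  words S (\sum_(i <- r) n i)%N (\sum_(i <- r) h i).
Proof.
move=> nh; elim/big_ind2: _ => [|n1 g1 n2 g2|i _]; last exact: nh.
- exact: words0.
- exact: wordsD.
Qed.

Lemma words_le S r1 r2 g : (r1 <= r2)%N -> words S r1 g -> words S r2 g.
Proof. by move=> r12 [s [sr sS gs]]; exists s; rewrite (leq_trans sr). Qed.

Lemma words_of_gen S g : monoid_generating S -> exists r, words S r g.
Proof. by move=> /(_ g)[s [sS gs]]; exists (size s), s. Qed.

(** As G is abelian, a word matters only through the number of occurrences of
    each generator; this makes growth polynomial. *)
Lemma word_multiplicities (I : finType) (e : I -> G) (s : seq G) :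
    {in s, forall x, exists i, x = e i} ->
  exists m : I -> nat,
    (\sum_i m i = size s)%N /\ \sum_(x <- s) x = \sum_i e i *+ m i.
Proof.
elim: s => [|x s IH] se.
  by exists (fun=> 0%N); rewrite big1// big_nil big1.
have [|m [ms gm]] := IH.
  by move=> y ys; apply: se; rewrite in_cons ys orbT.
have [i xi] := se x (mem_head _ _).
exists (fun j => (i == j) + m j)%N; split.
  rewrite big_split/= ms (bigD1 i)//= eqxx big1// => j /negPf.
  by rewrite eq_sym => ->.
rewrite big_cons gm; under [RHS]eq_bigr do rewrite mulrnDr.
rewrite big_split/= xi; congr (_ + _).
rewrite (bigD1 i)//= eqxx big1 ?addr0// => j /negPf.
by rewrite eq_sym => ->.
Qed.

Lemma growth_le_card S r (T : finType) (h : T -> G) :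
  monoid_generating S -> (words S r `<=` range h)%classic ->
  finite_set (Defs.ball S r) /\ (growth S r <= #|T|)%N.
Proof.
move=> Sgen wh; rewrite /growth ball_words//.
have fin : finite_set (words S r).
  apply: sub_finite_set wh _; exact: finite_image.
split=> //; rewrite -cardsT.
apply: (@leq_trans #|` [fset h x | x in [set: T]%SET]%fset|); last first.
  by rewrite (leq_trans (leq_imfset_card _ _ _))// cardE.
apply: fsubset_leq_card; apply/fsubsetP => g.
rewrite in_fset_set// inE => /wh[x _ <-]; apply: in_imfset.
by rewrite inE.
Qed.

Lemma growth_poly S r : monoid_generating S ->
  finite_set (Defs.ball S r) /\ (growth S r <= (r + 1) ^ #|` S|)%N.
Proof.
move=> Sgen; rewrite addn1.
have -> : (r.+1 ^ #|` S| = #|{ffun S -> 'I_r.+1}|)%N.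
  by rewrite card_ffun card_ord cardfE.
apply: (@growth_le_card _ _ _ (fun m : {ffun S -> 'I_r.+1} =>
   \sum_(i : S) fsval i *+ m i)) => // g [s [sr sS ->]].
have [|m [ms ->]] := @word_multiplicities S (fun i => fsval i) s.
  by move=> x /sS xS; exists [` xS]%fset.
exists [ffun i => inord (m i)] => //; apply: eq_bigr => i _.
rewrite ffunE inordK// ltnS (leq_trans _ sr)// -ms (bigD1 i)//=.
exact: leq_addr.
Qed.

Lemma growth_ge_card S r (T : finType) (h : T -> G) :
  monoid_generating S -> injective h -> (forall x, words S r (h x)) ->
  (#|T| <= growth S r)%N.
Proof.
move=> Sgen hinj hw; have [fin _] := growth_poly r Sgen.
rewrite /growth -cardsT.
have -> : #|[set: T]%SET| = #|` [fset h x | x in [set: T]%SET]%fset|.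
  by rewrite card_imfset//= -cardE.
apply: fsubset_leq_card; apply/fsubsetP => g /imfsetP[x _ ->].
by rewrite in_fset_set// inE ball_words.
Qed.

Lemma growth_gt0 S r : monoid_generating S -> (0 < growth S r)%N.
Proof.
move=> Sgen; rewrite -card_unit.
apply: (@growth_ge_card _ _ _ (fun=> 0)) => //; first by move=> [] [].
by move=> _; exact: words_le (words0 S).
Qed.

Lemma symmetric_monoid_generating S :
  symmetric_set S -> group_generating S -> monoid_generating S.
Proof.
move=> Ssym Sgen g; have [s [sS ->]] := Sgen g; exists s; split=> // x /sS[//|].
by move=> /Ssym; rewrite opprK.
Qed.

End Balls.

(** * The rational rank map *)

Section Rank.
Variable G : zmodType.

Definition spanning_torsion_killing (d : nat) (phi : G -> 'rV[rat]_d) :=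
  (forall t, tors_set G t -> phi t = 0) /\
  forall S : {fset G}, monoid_generating S ->
    (<<[seq phi x | x <- S]>> = fullv)%VS.

(** Tensoring with Q.  When G / tors G is free, phi is the projection to
    G / tors G followed by Z^d -> Q^d.  Otherwise rk G is 0 by convention, and
    the zero map to Q^0 has the same two properties. *)
Lemma rank_map : exists phi : {additive G -> 'rV[rat]_(rk G)},
  spanning_torsion_killing phi.
Proof.
have tors0 d (phi : {additive G -> 'rV[rat]_d}) t : tors_set G t -> phi t = 0.
  move=> [n n0 tn]; apply/eqP; have /eqP := raddf0 phi.
  by rewrite -tn raddfMn -scaler_nat scaler_eq0 pnatr_eq0 eqn0Ngt n0.
rewrite /rk; case: xgetP => [d _ [f [f' f'K fK]]|_]; last first.
  exists (\0 : {additive G -> 'rV[rat]_0}); split=> [//|S _].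
  by apply/vspaceP => v; rewrite memvf thinmx0 mem0v.
pose Q := Quotient.quot (tors G).
pose p := \pi_Q%qT : {additive G -> Q}.
pose phi := (map_mx intr \o f \o p) : {additive G -> 'rV[rat]_d}.
exists phi; split=> [|S Sgen]; first exact: tors0.
apply/eqP; rewrite eqEsubv subvf; apply/subvP => v _.
rewrite (row_sum_delta v) memv_suml// => i _; apply: memvZ.
pose g := repr (f' (delta_mx 0 i)).
have -> : delta_mx 0 i = phi g.
  by rewrite /phi /= /p /g /= reprK fK map_delta_mx.
have [s [sS ->]] := Sgen g.
rewrite raddf_sum big_seq memv_suml// => x xs.
by rewrite memv_span// map_f// sS.
Qed.

End Rank.

(** * Lifting the cones to the group *)

Section LiftedFan.
Variables (G : zmodType) (d : nat) (phi : {additive G -> 'rV[rat]_d}).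
Variable S : {fset G}.
Hypothesis Sgen : monoid_generating S.
Hypothesis phiS : (<<[seq phi x | x <- S]>> = fullv)%VS.

(** The fan found in the image of S, each of its vectors being lifted to an
    element of S; the bases are numbered by 'I_d to match the coordinates of
    Z^d. *)
Lemma lifted_fan : exists (I : finType) (e : I -> 'I_d -> G),
  [/\ forall i j, e i j \in S, (d < #|I|)%N,
      forall i (a : 'I_d -> rat),
        \sum_j a j *: phi (e i j) = 0 -> forall j, a j = 0 &
      forall i k (a b : 'I_d -> rat),
        (forall j, 0 < a j) -> (forall j, 0 < b j) ->
        \sum_j a j *: phi (e i j) = \sum_j b j *: phi (e k j) -> i = k].
Proof.
pose X := [seq phi x | x <- S].
have [|I [F [Fbasis FX cardI Finj]]] := @positive_fan rat _ X.
  move=> _ /mapP[x xS ->]; have [s [sS xs]] := Sgen (- x).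
  exists [seq phi y | y <- s].
    by move=> _ /mapP[y ys ->]; rewrite map_f// sS.
  by rewrite big_map -raddfN xs raddf_sum.
have dimX : \dim <<X>>%VS = d by rewrite phiS dimvf; exact: mul1n.
have sizeF i : size (F i) = d.
  have := basis_free (Fbasis i).
  by rewrite /free (span_basis (Fbasis i)) dimX => /eqP.
have ltF i (j : 'I_d) : (j < size (F i))%N by rewrite sizeF.
have liftX v : exists x, v \in X -> x \in S /\ phi x = v.
  have [/mapP[x xS ->]|vX] := boolP (v \in X); last by exists 0.
  by exists x.
have [psi psiE] := choice liftX.
have FjX i (j : 'I_d) : (F i)`_j \in X by exact/FX/mem_nth/ltF.
pose e i (j : 'I_d) := psi (F i)`_j.
have phie i j : phi (e i j) = (F i)`_j by case: (psiE _ (FjX i j)).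
(* coefficients numbered by 'I_d, read as coefficients of vectors; the
   default 1 keeps them positive off the basis *)
pose coef i (a : 'I_d -> rat) v :=
  if insub (index v (F i)) is Some j then a j else 1.
have coefE i a (j : 'I_d) : coef i a (F i)`_j = a j.
  by rewrite /coef index_uniq ?ltF ?valK// (free_uniq (basis_free (Fbasis i))).
have sumE i a : \sum_(v <- F i) coef i a v *: v = \sum_j a j *: phi (e i j).
  rewrite (big_nth 0) sizeF big_mkord.
  by apply: eq_bigr => j _; rewrite coefE phie.
have coef_gt0 i a : (forall j, 0 < a j) -> {in F i, forall v, 0 < coef i a v}.
  by move=> a0 v _; rewrite /coef; case: insubP.
exists I, e; split.
- by move=> i j; case: (psiE _ (FjX i j)).
- by rewrite -dimX.
- move=> i a; rewrite -sumE => a0 j.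
  have /freeP_comb[_ /(_ _ a0)] := basis_free (Fbasis i).
  by move=> /(_ _ (mem_nth 0 (ltF i j))); rewrite coefE.
- move=> i k a b a0 b0; rewrite -!sumE.
  by apply: Finj; exact: coef_gt0.
Qed.

End LiftedFan.

(** * The standard generating sets of Z^d *)

Section StandardGenerators.
Variable d : nat.

Lemma std_basisP x : reflect (exists j, x = delta_mx 0 j) (x \in std_basis d).
Proof.
by apply: (iffP (imfsetP _ _ _ _)) => [[j _ ->]|[j ->]]; exists j.
Qed.

Lemma std_monoid_generating (S : {fset 'rV[int]_d}) :
    (forall j, exists r, words S r (delta_mx 0 j)) ->
    (forall j, exists r, words S r (- delta_mx 0 j)) ->
  monoid_generating S.
Proof.
move=> pos neg g.
have coord j : exists r, words S r (g 0 j *: delta_mx 0 j).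
  have mul n h : (exists r, words S r h) -> exists r, words S r (h *+ n).
    move=> [r hr]; exists (\sum_(i <- nseq n tt) r)%N.
    have -> : h *+ n = \sum_(i <- nseq n tt) h by rewrite big_nseq iter_addr_0.
    exact: words_sum.
  case: (g 0 j) => n; first by rewrite -[Posz n]natz scaler_nat; exact: mul.
  by rewrite NegzE -[Posz _]natz scaleNr scaler_nat -mulNrn; exact: mul.
have [r rP] := choice coord.
have [s [_ sS gs]] := words_sum (index_enum 'I_d) rP.
by exists s; split=> //; rewrite -gs -row_sum_delta.
Qed.

Lemma words_mem (G : zmodType) (S : {fset G}) x : x \in S -> words S 1 x.
Proof. by move=> xS; rewrite -[x]mulr1n; exact: wordsMn. Qed.

Lemma symmetric_std_generating :
  monoid_generating (std_basis d `|` neg_std_basis d)%fset.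
Proof.
apply: std_monoid_generating => j; exists 1%N; apply: words_mem.
  by rewrite inE; apply/orP; left; apply/std_basisP; exists j.
rewrite inE; apply/orP; right; apply/imfsetP; exists (delta_mx 0 j) => //.
by apply/std_basisP; exists j.
Qed.

(** All d + 1 generators are put in one family, as they play symmetric roles:
    any d of them generate Z^d freely and the sum of all is 0. *)
Definition plus_generator (i : 'I_d.+1) : 'rV[int]_d :=
  if unlift ord0 i is Some j then delta_mx 0 j else const_mx (-1).

Lemma plus_generatorP x :
  reflect (exists i, x = plus_generator i)
    (x \in std_basis d `|` [fset (const_mx (-1) : 'rV[int]_d)])%fset.
Proof.
rewrite !inE; apply: (iffP orP).
  move=> [/std_basisP[j ->]|/eqP->].
    by exists (lift ord0 j); rewrite /plus_generator liftK.
  by exists ord0; rewrite /plus_generator unlift_none.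
move=> [i ->]; rewrite /plus_generator; case: unliftP => [j _|_].
  by left; apply/std_basisP; exists j.
by right.
Qed.

Lemma sum_plus_generator : \sum_i plus_generator i = 0.
Proof.
rewrite big_ord_recl {1}/plus_generator unlift_none.
under eq_bigr do rewrite /plus_generator liftK.
have -> : \sum_j delta_mx 0 j = const_mx 1 :> 'rV[int]_d.
  rewrite [RHS]row_sum_delta; apply: eq_bigr => j _.
  by rewrite mxE scale1r.
by apply/rowP => j; rewrite !mxE addNr.
Qed.

Lemma plus_std_generating :
  monoid_generating (std_basis d `|` [fset const_mx (-1)])%fset.
Proof.
have gen i :
    words (std_basis d `|` [fset const_mx (-1)])%fset 1 (plus_generator i).
  by apply: words_mem; apply/plus_generatorP; exists i.
have deltaE j : delta_mx 0 j = plus_generator (lift ord0 j).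
  by rewrite /plus_generator liftK.
apply: std_monoid_generating => j; first by exists 1%N; rewrite deltaE.
(* - e_j is the sum of the other generators *)
have /eqP := sum_plus_generator.
rewrite (bigD1_ord (lift ord0 j))//= -deltaE addr_eq0 => /eqP->.
rewrite opprK; eexists; apply: words_sum => i; exact: gen.
Qed.

End StandardGenerators.

(** * Comparing balls in G and in Z^d *)

Section Comparison.
Variables (G : zmodType) (d : nat) (phi : {additive G -> 'rV[rat]_d}).
Hypothesis phi_rank : spanning_torsion_killing phi.
Variable S : {fset G}.
Hypothesis Sgen : monoid_generating S.
Variable T : {fset G}.
Hypothesis Ttors : forall t, t \in T -> tors_set G t.

Lemma torsion_word_bound : exists c, forall t : T, words S c (val t).
Proof.
have [r rP] := choice (fun t : T => words_of_gen (val t) Sgen).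
exists (\sum_t r t)%N => t; apply: words_le (rP t).
by rewrite (bigD1 t)//= leq_addr.
Qed.

Lemma phi_torsion (t : T) x : phi (val t + x) = phi x.
Proof. by rewrite raddfD/= phi_rank.1 ?add0r//; apply/Ttors/valP. Qed.

(** The homomorphism f sending e_j to s_j maps the generators of Z^d into S,
    S being symmetric, so it does not increase word length.  The constant is
    the cost of spelling the elements of T. *)
Lemma symmetric_growth_comparison : symmetric_set S ->
  exists c, forall r, (#|` T| * std_growth d r <= growth S (r + c))%N.
Proof.
move=> Ssym; have [c cP] := torsion_word_bound.
have [I [e [eS cardI efree _]]] := lifted_fan Sgen (phi_rank.2 _ Sgen).
have /card_gt0P[i _] : (0 < #|I|)%N by exact: leq_ltn_trans cardI.
pose f (x : 'rV[int]_d) := \sum_j e i j *~ x 0 j.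
have fD x y : f (x + y) = f x + f y.
  by rewrite -big_split; apply: eq_bigr => j _; rewrite mxE mulrzDr.
have f0 : f 0 = 0 by apply: big1 => j _; rewrite mxE mulr0z.
have fN x : f (- x) = - f x by apply/eqP; rewrite -addr_eq0 -fD addNr f0.
have fdelta j : f (delta_mx 0 j) = e i j.
  rewrite /f (bigD1 j)//= mxE !eqxx big1 ?addr0// => k /negPf kj.
  by rewrite mxE kj andbF.
have fwords r x :
    words (std_basis d `|` neg_std_basis d)%fset r x -> words S r (f x).
  move=> [s [sr sE ->]]; exists [seq f y | y <- s].
  rewrite size_map; split=> //.
    move=> _ /mapP[y /sE ys ->]; move: ys; rewrite inE => /orP[|].
      by move=> /std_basisP[j ->]; rewrite fdelta.
    move=> /imfsetP[_ /std_basisP[j ->] ->].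
    by rewrite fN fdelta Ssym.
  by rewrite big_map (big_morph f fD f0).
have phif x : phi (f x) = \sum_j (x 0 j)%:~R *: phi (e i j).
  by rewrite raddf_sum; apply: eq_bigr => j _; rewrite raddfMz scaler_int.
have finj t u x y : phi (val (t : T) + f x) = phi (val (u : T) + f y) -> x = y.
  rewrite !phi_torsion => xy; apply/rowP => j; apply/eqP.
  rewrite -subr_eq0 -(intr_eq0 rat).
  apply/eqP; apply: (efree i (fun j => (x 0 j - y 0 j)%:~R)).
  transitivity (phi (f x) - phi (f y)); last by rewrite xy subrr.
  rewrite !phif -sumrB; apply: eq_bigr => k _.
  by rewrite rmorphB scalerBl.
exists c => r.
have Bgen := @symmetric_std_generating d.
pose B := fset_set (Defs.ball (std_basis d `|` neg_std_basis d)%fset r).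
have -> : (#|` T| * std_growth d r = #|{: T * B}|)%N.
  by rewrite card_prod -!cardfE.
apply: (@growth_ge_card _ _ _ _ (fun p => val p.1 + f (val p.2))) => //.
  move=> [t x] [u y] /= txuy.
  have xy := finj _ _ _ _ (congr1 phi txuy).
  by rewrite xy in txuy; congr (_, _); apply: val_inj => //; exact: addIr txuy.
move=> [t x] /=; rewrite addnC; apply: wordsD; first exact: cP.
apply: fwords; rewrite -ball_words//.
have := valP x; rewrite in_fset_set ?inE//.
by have [] := growth_poly r Bgen.
Qed.

Local Notation simplex r := {x : {ffun 'I_d -> 'I_r.+1} | (\sum_j x j <= r)%N}.

(** In a word in the generators of Z^d, removing the same number of occurrences
    of each of them does not change the sum; hence the least used generator
    i0 can be eliminated, and the d others have multiplicities x. *)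
Lemma std_growth_plus_le r :
  (std_growth_plus d r <= d.+1 * #|{: simplex r}|)%N.
Proof.
have <- : (#|{: 'I_d.+1 * simplex r}| = d.+1 * #|{: simplex r}|)%N.
  by rewrite card_prod card_ord.
pose h (p : 'I_d.+1 * simplex r) :=
  \sum_j plus_generator (lift p.1 j) *+ (val p.2 j).
apply: (@growth_le_card _ _ _ _ h (@plus_std_generating d) _).2.
move=> g [s [sr sS ->]].
have [|m [ms ->]] := @word_multiplicities _ _ (@plus_generator d) s.
  by move=> x /sS/plus_generatorP.
pose i0 := [arg min_(i < ord0) m i].
have i0min i : (m i0 <= m i)%N.
  by rewrite /i0; case: arg_minnP => // k _; apply.
have msr j : (m (lift i0 j) - m i0 <= r)%N.
  rewrite (leq_trans (leq_subr _ _))// (leq_trans _ sr)// -ms.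
  by rewrite (bigD1 (lift i0 j))//= leq_addr.
pose x := [ffun j => inord (m (lift i0 j) - m i0) : 'I_r.+1].
have xE j : x j = (m (lift i0 j) - m i0)%N :> nat.
  by rewrite ffunE inordK// ltnS.
have xr : (\sum_j x j <= r)%N.
  apply: leq_trans sr; rewrite -ms (bigD1_ord i0)//=.
  rewrite (leq_trans _ (leq_addl _ _))//.
  by apply: leq_sum => j _; rewrite xE leq_subr.
exists (i0, Sub x xr : simplex r) => //; rewrite /h /=.
under eq_bigr do rewrite xE mulrnBr//.
rewrite sumrB; have /eqP := congr1 (fun g => g *+ m i0) (@sum_plus_generator d).
rewrite mul0rn -sumrMnl (bigD1_ord i0)//= addrC addr_eq0 => /eqP->.
by rewrite opprK [RHS](bigD1_ord i0)//= addrC.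
Qed.

(** Only positive combinations are known to determine the cone, so the
    multiplicities x are shifted by 1; this lengthens words by d. *)
Lemma monoid_growth_comparison :
  exists c, forall r, (#|` T| * std_growth_plus d r <= growth S (r + c))%N.
Proof.
have [c cP] := torsion_word_bound.
have [I [e [eS cardI efree einj]]] := lifted_fan Sgen (phi_rank.2 _ Sgen).
exists (c + d)%N => r.
have: (#|` T| * std_growth_plus d r <= #|{: T * (I * simplex r)}|)%N.
  rewrite !card_prod -cardfE leq_mul// (leq_trans (std_growth_plus_le r))//.
  by rewrite leq_mul.
move=> /leq_trans; apply.
pose f i (x : simplex r) := \sum_j e i j *+ (val x j).+1.
have phif i x : phi (f i x) = \sum_j ((val x j).+1)%:R *: phi (e i j).
  rewrite raddf_sum; apply: eq_bigr => j _.
  by rewrite raddfMn scaler_nat.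
apply: (@growth_ge_card _ _ _ _ (fun p => val p.1 + f p.2.1 p.2.2)) => //.
  move=> [t [i x]] [u [k y]] /= E.
  have := congr1 phi E; rewrite !phi_torsion !phif => ixky.
  have ik : i = k by apply: einj ixky => j; rewrite ltr0n.
  have xy : x = y.
    apply/val_inj/ffunP => j; apply/val_inj/eqP.
    rewrite -eqSS -(eqr_nat rat) -subr_eq0; apply/eqP.
    apply: (efree i (fun j => ((val x j).+1)%:R - ((val y j).+1)%:R)).
    under eq_bigr do rewrite scalerBl.
    by rewrite sumrB ixky ik subrr.
  by move: E; rewrite ik xy => /addIr/val_inj->.
move=> [t [i x]] /=; rewrite addnCA; apply: wordsD; first exact: cP.
have : (\sum_j (val x j).+1 <= r + d)%N.
  under eq_bigr do rewrite -addn1.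
  rewrite big_split/= sum1_card card_ord leq_add2r; exact: (valP x).
by move=> /words_le; apply; apply: words_sum => j; exact: wordsMn.
Qed.

End Comparison.

(** If A is infinite, its counting measure is +oo, and arbitrarily large finite
    subsets force l = +oo. *)
Lemma counting_le (R : realType) (U : choiceType) (A : set U) (l : \bar R) :
    (forall T : {fset U},
      (forall t, t \in T -> A t) -> (#|` T|%:R%:E <= l)%E) ->
  (counting A <= l)%E.
Proof.
move=> Al; rewrite /counting; case: asboolP => [Afin|Ainf].
  by apply: Al => t; rewrite in_fset_set// inE.
rewrite (eq_infty (x := l))// => x.
have [T TA cardT] := infinite_set_fset (Num.Def.truncn x).+1 Ainf.
apply: le_trans (Al T _); last by move=> t tT; exact: TA.
by rewrite lee_fin (le_trans (ltW (truncnS_gt x)))// ler_nat.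
Qed.

Theorem proposition1p6 (R : realType) (G : zmodType)
    (Gfg : finitely_generated G) :
  (forall S : {fset G}, symmetric_set S -> group_generating S ->
     (counting (tors_set G) <=
      limn_esup (fun r : nat =>
        ((growth S r)%:R / (std_growth (rk G) r)%:R : R)%:E))%E) /\
  (forall S : {fset G}, monoid_generating S ->
     (counting (tors_set G) <=
      limn_esup (fun r : nat =>
        ((growth S r)%:R / (std_growth_plus (rk G) r)%:R : R)%:E))%E).
Proof.
have [phi phi_rank] := rank_map G.
split=> [S Ssym Sgen|S Sgen]; apply: counting_le => T Ttors.
  have Smon := symmetric_monoid_generating Ssym Sgen.
  have [c cP] := symmetric_growth_comparison phi_rank Smon Ttors Ssym.
  apply: limsup_ratio_ge cP => r.
    exact/growth_gt0/symmetric_std_generating.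
  exact: (growth_poly r (@symmetric_std_generating _)).2.
have [c cP] := monoid_growth_comparison phi_rank Sgen Ttors.
apply: limsup_ratio_ge cP => r.
  exact/growth_gt0/plus_std_generating.
exact: (growth_poly r (@plus_std_generating _)).2.
Qed.
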